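(* Let $k$ be a field with $u(k)\leq 2$ which is not quadratically closed, with $\mathrm{char}(k)\neq 2$ and $|k|\geq 5$. Let $G:=\mathrm{SL}_2(k)$ and let $\mathscr{C}$ be a semisimple conjugacy class in $G$. (1) If $\mathscr{C}$ is split semisimple, then $\mathscr{C}^2=G\setminus \{-I\}$ unless $\mathrm{tr}(\mathscr{C})=0$, in which case $-1\in k^{\times 2}$ and $\mathscr{C}^2=G$. (2) If $\mathscr{C}$ is non-split semisimple, then $\mathscr{C}^2=G\setminus (\{\text{unipotent elements}\}\cup\{-I\})$ unless $\mathrm{tr}(\mathscr{C})=0$, in which case $-1 \notin k^{\times 2}$ and $\mathscr{C}^2=G\setminus (\{\text{unipotent elements}\}\cup\{\text{negative unipotent elements}\})$.
   Context: A field $k$ has $u(k)\leq 2$ if every quadratic form in $3$ variables over $k$ is isotropic. A field is quadratically closed if it admits no quadratic extension. $k^{\times 2}$ is the set of squares in $k^\times$. A semisimple class means a non-central semisimple conjugacy class; it is split if its elements are diagonalizable over $k$ (eigenvalues $\alpha,\alpha^{-1}$, $\alpha\in k^\times\setminus\{\pm1\}$) and non-split if their characteristic polynomial is irreducible over $k$. A unipotent element means one with minimal polynomial $(X-1)^2$ (so $I$ is not counted), and a negative unipotent element means one with minimal polynomial $(X+1)^2$ (so $-I$ is not counted). $\mathrm{tr}(\mathscr{C})$ is the common trace of the elements of $\mathscr{C}$. $\mathscr{C}^2=\{xy:x,y\in\mathscr{C}\}$. *)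

(* Defs.v *)
From HB Require Import structures.
From mathcomp Require Import all_boot all_order all_algebra all_field.
From mathcomp Require Import boolp classical_sets.

Set Implicit Arguments.
Unset Strict Implicit.
Unset Printing Implicit Defensive.

Import GRing.Theory.
Local Open Scope ring_scope.
Local Open Scope classical_set_scope.

Section Fields.
Variable k : fieldType.

(* The quadratic form \sum_(i, j) A i j x_i x_j.  The matrix A is arbitrary,
   not assumed symmetric, so every homogeneous polynomial of degree 2 arises. *)
Definition qform (n : nat) (A : 'M[k]_n) (x : 'rV[k]_n) : k :=
  \sum_(i < n) \sum_(j < n) A i j * x ord0 i * x ord0 j.

Definition isotropic (n : nat) (A : 'M[k]_n) : Prop :=
  exists2 x : 'rV[k]_n, x != 0 & qform A x = 0.

Definition u_le2 : Prop := forall A : 'M[k]_3, isotropic A.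

Definition quadratically_closed : Prop :=
  ~ exists L : fieldExtType k, \dim {:L} = 2%N.

Definition card_ge5 : Prop := exists2 s : seq k, uniq s & (5 <= size s)%N.

Definition nz_squares : set k := [set a | exists2 b : k, b != 0 & a = b ^+ 2].

End Fields.

Section SL2.
Variable k : fieldType.
Implicit Types (g : 'M[k]_2) (C : set 'M[k]_2).

Definition SL2 : set 'M[k]_2 := [set g | \det g = 1].

Definition central g : Prop := forall h, SL2 h -> g *m h = h *m g.

(* Diagonalizable over some finite extension of k, equivalently over an
   algebraic closure. *)
Definition semisimple g : Prop :=
  exists L : fieldExtType k, diagonalizable (map_mx (in_alg L) g).

Definition conj_class g : set 'M[k]_2 :=
  [set h *m g *m invmx h | h in SL2].

Definition semisimple_class C : Prop :=
  exists g, [/\ SL2 g, semisimple g, ~ central g & C = conj_class g].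

(* For a semisimple class (non-central by definition), the eigenvalues are then
   automatically a, a^-1 with a in k and a different from 0, 1 and -1. *)
Definition split_class C : Prop := forall g, C g -> diagonalizable g.

Definition nonsplit_class C : Prop :=
  forall g, C g -> irreducible_poly (char_poly g).

(* The trace of a chosen element of C; see class_trE. *)
Definition class_tr C : k := \tr (xget 0 C).

Definition class_sqr C : set 'M[k]_2 := [set x *m y | x in C & y in C].

Definition unipotents : set 'M[k]_2 :=
  [set g | SL2 g /\ mxminpoly g = ('X - 1) ^+ 2].

Definition neg_unipotents : set 'M[k]_2 :=
  [set g | SL2 g /\ mxminpoly g = ('X + 1) ^+ 2].

Lemma class_trE C g : semisimple_class C -> C g -> class_tr C = \tr g.
Proof.
move=> [g0 [_ _ _ ->]] Cg.
suff trE x : conj_class g0 x -> \tr x = \tr g0.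
  by rewrite /class_tr !trE //; exact: xgetI Cg.
move=> [h hSL <-]; rewrite mxtrace_mulC mulmxA mulVmx ?mul1mx //.
by rewrite unitmxE (hSL : \det h = 1) unitr1.
Qed.

End SL2.

Arguments nz_squares : clear implicits.
Arguments SL2 : clear implicits.
Arguments unipotents : clear implicits.
Arguments neg_unipotents : clear implicits.

(* Main.v *)
(** A semisimple class of trace [t] is the set of all [x] in SL_2(k) with trace
    [t]: any two such matrices have a cyclic vector, hence are conjugate under
    GL_2(k), and [u(k) <= 2] makes the norm form of the centralizer [k[x]]
    universal, so the determinant of the conjugating matrix can be set to 1.
    For [z] with trace [s], put in companion form, [z = x y] with [x, y] in the
    class amounts to a point on the affine conic
    [a^2 + s a c + c^2 - t a - t c + 1 = 0].  Its projective closure has a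
    rational point since [u(k) <= 2]; when that point is at infinity and
    [s <> 2, -2] the quadratic part is hyperbolic and the conic still has affine
    points, while for [s = 2] or [s = -2] the conic is solved directly. *)

Require Import Defs.
From HB Require Import structures.
From mathcomp Require Import all_boot all_order all_algebra all_field.
From mathcomp Require Import boolp classical_sets.
From mathcomp Require Import ring.

Set Implicit Arguments.
Unset Strict Implicit.
Unset Printing Implicit Defensive.

Import GRing.Theory.
Local Open Scope ring_scope.
Local Open Scope classical_set_scope.

Section Matrices2.
Variable k : fieldType.
Implicit Types (a b c d r s t : k) (g x y z P : 'M[k]_2).

(** * Two-by-two matrices and companion form *)

Definition mx2 a b c d : 'M[k]_2 :=
  \matrix_(i, j) if i == 0 then (if j == 0 then a else b)
                 else (if j == 0 then c else d).

Lemma mx2P g : exists a b c d, g = mx2 a b c d.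
Proof.
exists (g 0 0), (g 0 1), (g 1 0), (g 1 1).
apply/matrixP => i j; rewrite mxE.
by case: i => [[|[|]]] //= hi; case: j => [[|[|]]] //= hj;
  congr (g _ _); apply: val_inj.
Qed.

Lemma mul_mx2 a b c d a' b' c' d' :
  mx2 a b c d *m mx2 a' b' c' d' =
  mx2 (a * a' + b * c') (a * b' + b * d') (c * a' + d * c') (c * b' + d * d').
Proof.
apply/matrixP => i j; rewrite !mxE !big_ord_recl big_ord0 addr0 !mxE /=.
by case: i => [[|[|]]] //= hi; case: j => [[|[|]]].
Qed.

Lemma det_mx2 a b c d : \det (mx2 a b c d) = a * d - b * c.
Proof.
rewrite (expand_det_row _ 0) !big_ord_recl big_ord0 addr0 /cofactor !det_mx11.
by rewrite !mxE /= !expr0 !expr1; ring.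
Qed.

Lemma tr_mx2 a b c d : \tr (mx2 a b c d) = a + d.
Proof. by rewrite /mxtrace !big_ord_recl big_ord0 addr0 !mxE. Qed.

Lemma scalar_mx2 a : a%:M = mx2 a 0 0 a.
Proof.
apply/matrixP => i j; rewrite !mxE.
by case: i => [[|[|]]] //= hi; case: j => [[|[|]]].
Qed.

(** The companion matrix of [X^2 - s X + 1], acting on row vectors. *)
Definition companion s := mx2 0 1 (- 1) s.

(** If neither [(1, 0)] nor [(0, 1)] is cyclic, the matrix is diagonal; being non-scalar it has
    distinct entries, and [(1, 1)] is cyclic. *)
Lemma companionP z : \det z = 1 -> ~~ is_scalar_mx z ->
  exists2 P, P \in unitmx & P *m z = companion (\tr z) *m P.
Proof.
have [a [b [c [d ->]]]] := mx2P z; rewrite det_mx2 tr_mx2 => det1 nsc.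
(* The rows of the base change are a row vector v and v *m z. *)
have cyc p q : p * (p * b + q * d) - q * (p * a + q * c) != 0 ->
    exists2 P, P \in unitmx &
      P *m mx2 a b c d = companion (a + d) *m P.
  move=> nz; exists (mx2 p q (p * a + q * c) (p * b + q * d)).
    by rewrite unitmxE det_mx2 unitfE.
  (* The second row is Cayley-Hamilton, [v z^2 = (\tr z) v z - v]; the determinant must be inserted
     by hand for [ring] to see it. *)
  have detM u : u = u * (a * d - b * c) by rewrite det1 mulr1.
  rewrite !mul_mx2; congr mx2; [by ring | by ring | |].
    by rewrite [X in _ = - 1 * X + _]detM; ring.
  by rewrite [X in _ = - 1 * X + _]detM; ring.
have [b0|/eqP nb] := eqVneq b 0; last first.
  by apply: (cyc 1 0); rewrite !mul1r !mul0r subr0 addr0; apply/eqP.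
have [c0|nc] := eqVneq c 0; last first.
  by apply: (cyc 0 1); rewrite !mul0r !mul1r !add0r oppr_eq0.
apply: (cyc 1 1); rewrite b0 c0 !mul1r add0r addr0 subr_eq0.
apply: contraNneq nsc => ->; rewrite b0 c0 -scalar_mx2.
exact: scalar_mx_is_scalar.
Qed.

(** * Trace fibres of SL_2(k) and the trace conic *)

Definition SL2_tr t : set 'M[k]_2 := [set x | \det x = 1 /\ \tr x = t].

Lemma SL2_tr_conj P t x : P \in unitmx -> SL2_tr t x ->
  SL2_tr t (P *m x *m invmx P).
Proof.
move=> uP [dx tx]; split.
  by rewrite !det_mulmx det_inv dx mulr1 divrr // -unitmxE.
by rewrite mxtrace_mulC mulmxA mulVmx // mul1mx.
Qed.

Lemma class_sqr_SL2_tr_conj P t z : P \in unitmx ->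
  class_sqr (SL2_tr t) z -> class_sqr (SL2_tr t) (P *m z *m invmx P).
Proof.
move=> uP [x Cx [y Cy <-]].
exists (P *m x *m invmx P); first exact: SL2_tr_conj.
exists (P *m y *m invmx P); first exact: SL2_tr_conj.
by rewrite /= !mulmxA mulmxKV.
Qed.

(** Let [x] have first column [(a, -c)]. Then [\tr x = t] fixes its last diagonal entry, and
    [\tr (x^-1 z) = t] its upper right entry; the remaining condition [\det x = 1] is the conic. *)
Lemma class_sqr_companion s t :
  class_sqr (SL2_tr t) (companion s) <->
  exists a c, a ^+ 2 + s * a * c + c ^+ 2 - t * a - t * c + 1 = 0.
Proof.
split=> [[x [dx tx] [y [_ ty]]] | [a [c E]]].
  have [a [b [c [d Dx]]]] := mx2P x; rewrite {x}Dx in dx tx *.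
  move: dx tx; rewrite det_mx2 tr_mx2 => dx tx /(congr1 (mulmx (mx2 d (- b) (- c) a))).
  rewrite mulmxA mul_mx2.
  have -> : mx2 (d * a + - b * c) (d * b + - b * d) (- c * a + a * c)
      (- c * b + a * d) = 1%:M.
    by rewrite scalar_mx2; congr mx2; rewrite -?dx; ring.
  rewrite mul1mx /companion mul_mx2 => Dy; rewrite Dy tr_mx2 in ty.
  exists a, (- c).
  have Eb : b = t + c - a * s by rewrite -ty; ring.
  have Ed : d = t - a by rewrite -tx; ring.
  by rewrite Ed Eb in dx; rewrite -[X in _ + X = _]dx; ring.
exists (mx2 a (t - c - a * s) (- c) (t - a)).
  split; last by rewrite tr_mx2; ring.
  by rewrite det_mx2 -[RHS]subr0 -[in RHS]E; ring.
exists (mx2 (t - a) (- (t - c - a * s)) c a *m companion s).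
  rewrite mul_mx2; split; last by rewrite tr_mx2; ring.
  by rewrite det_mx2 -[RHS]subr0 -[in RHS]E; ring.
rewrite /= mulmxA mul_mx2.
have -> : a * (t - a) + (t - c - a * s) * c = 1.
  by rewrite -[RHS]subr0 -[in RHS]E; ring.
have -> : - c * - (t - c - a * s) + (t - a) * a = 1.
  by rewrite -[RHS]subr0 -[in RHS]E; ring.
by rewrite mul_mx2; congr mx2; ring.
Qed.

(** * Minimal polynomials and unipotent elements *)

Lemma char_poly_mx2E g : \det g = 1 ->
  char_poly g = 'X ^+ 2 - (\tr g) *: 'X + 1.
Proof.
move=> dg; apply/polyP => i; rewrite coefD coefB coefZ coefXn coefX coef1.
have mon := char_poly_monic g; have sz := size_char_poly g.
case: i => [|[|[|i]]] /=.
- by rewrite char_poly_det dg expr2 !mulN1r opprK; ring.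
- by rewrite (char_poly_trace g isT); ring.
- by move/monicP: mon; rewrite lead_coefE sz /= => ->; ring.
- by rewrite nth_default ?sz //; ring.
Qed.

Lemma mxminpoly_nonscalar g : ~~ is_scalar_mx g -> mxminpoly g = char_poly g.
Proof.
rewrite -mxminpoly_linear_is_scalar -ltnNge => d2.
apply/eqP; rewrite -eqp_monic ?mxminpoly_monic ?char_poly_monic //.
rewrite -dvdp_size_eqp ?mxminpoly_dvd_char // size_char_poly size_mxminpoly.
rewrite eqn_leq [X in _ && X]ltnS d2 andbT -size_mxminpoly -(size_char_poly g).
by rewrite dvdp_leq ?mxminpoly_dvd_char ?monic_neq0 ?char_poly_monic.
Qed.

(** Since [e^2 = 1], the square is [X^2 - 2 e X + 1], so comparison with the characteristic
    polynomial only involves the trace. The cases [e = 1] and [e = -1] give the unipotents and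
    negative unipotents. *)
Lemma mxminpoly_sqr_XsubC g e : \det g = 1 -> e ^+ 2 = 1 ->
  mxminpoly g = ('X - e%:P) ^+ 2 <-> ~~ is_scalar_mx g /\ \tr g = 2%:R * e.
Proof.
move=> dg e2.
have sqE : ('X - e%:P) ^+ 2 = 'X^2 - (2%:R * e) *: 'X + 1.
  have -> : 1 = e%:P ^+ 2 :> {poly k} by rewrite -rmorphXn e2.
  by rewrite -mul_polyC rmorphM rmorph_nat; ring.
split=> [E | [nsc tr2]]; last first.
  by rewrite mxminpoly_nonscalar // char_poly_mx2E // tr2 sqE.
have nsc : ~~ is_scalar_mx g.
  rewrite -mxminpoly_linear_is_scalar -ltnNge -ltnS -size_mxminpoly E.
  by rewrite size_exp_XsubC.
split=> //; move: E; rewrite mxminpoly_nonscalar // char_poly_mx2E // sqE.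
move=> /(congr1 (fun p : {poly k} => - p`_1)).
rewrite !coefD !coefN !coefZ !coefX !coefXn !coef1 /= => E.
by move: E; rewrite !add0r !addr0 !opprK !mulr1.
Qed.

Lemma unipotentsP g : \det g = 1 ->
  unipotents k g <-> ~~ is_scalar_mx g /\ \tr g = 2%:R.
Proof.
move=> dg; have := mxminpoly_sqr_XsubC dg (expr1n k 2).
rewrite mulr1 => <-; split=> [[] // | E]; by split.
Qed.

Lemma neg_unipotentsP g : \det g = 1 ->
  neg_unipotents k g <-> ~~ is_scalar_mx g /\ \tr g = - 2%:R.
Proof.
have e2 : (- 1) ^+ 2 = 1 :> k by rewrite sqrrN expr1n.
move=> dg; have := mxminpoly_sqr_XsubC dg e2.
by rewrite mulrN1 polyCN opprK => <-; split=> [[] // | E]; split.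
Qed.

End Matrices2.

(** * Isotropy, the norm form and solvability of the conic *)

Section Proposition.
Variable k : fieldType.
Hypotheses (hu : u_le2 k) (hchar : 2%N \notin [pchar k]).
Implicit Types (a b c r s t : k) (g x y z P : 'M[k]_2).

(** The eigenvalues of a determinant-one matrix of trace [t] lie in k. *)
Definition split_trace t := exists r, r ^+ 2 - t * r + 1 = 0.

Lemma natr2_neq0 : 2%:R != 0 :> k.
Proof. by move: hchar; rewrite inE. Qed.

Lemma ternary_isotropic a b c d e f : exists x y z : k,
  ~ [/\ x = 0, y = 0 & z = 0] /\
  a * x ^+ 2 + b * y ^+ 2 + c * z ^+ 2 + d * x * y + e * x * z + f * y * z = 0.
Proof.
(* Upper triangular, so each cross term sits in one entry and no factor 2 appears. *)
pose A : 'M[k]_3 := \matrix_(i, j)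
  nth 0 (nth [::] [:: [:: a; d; e]; [:: 0; b; f]; [:: 0; 0; c]] i) j.
have [v nzv qv] := hu A.
exists (v 0 0), (v 0 1), (v 0 2%:R); split.
  case=> v0 v1 v2; case/eqP: nzv; apply/rowP => i; rewrite mxE.
  case: i => [[|[|[|]]]] //= hi.
  - by rewrite -[RHS]v0; congr (v _ _); apply: val_inj.
  - by rewrite -[RHS]v1; congr (v _ _); apply: val_inj.
  - by rewrite -[RHS]v2; congr (v _ _); apply: val_inj.
rewrite -[RHS]qv /qform !big_ord_recl !big_ord0 !mxE /=.
have -> : lift ord0 ord0 = 1 :> 'I_3 by apply: val_inj.
have -> : lift ord0 (lift ord0 ord0) = 2%:R :> 'I_3 by apply: val_inj.
ring.
Qed.

(* If the isotropic vector lies on the line at infinity, the binary form splits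
   into distinct linear factors, hence is universal. *)
Lemma norm_form_universal t e : t != 2%:R -> t != - 2%:R ->
  exists a b, a ^+ 2 + t * a * b + b ^+ 2 = e.
Proof.
move=> t2 tm2; have [x [y [w [nz E]]]] := ternary_isotropic 1 1 (- e) t 0 0.
have [w0|nw] := eqVneq w 0; last first.
  exists (x / w), (y / w).
  apply/(mulIf (mulf_neq0 nw nw))/eqP; rewrite -subr_eq0 -[X in _ == X]E.
  by apply/eqP; field.
have ny : y != 0.
  apply/eqP => y0; case: nz; split=> //; move: E; rewrite w0 y0.
  rewrite !(expr0n, mulr0, mul0r, addr0, mul1r) /= => /eqP.
  by rewrite expf_eq0 => /eqP.
pose r := x / y.
have Er : r * (- t - r) = 1.
  apply/eqP; rewrite -subr_eq0; apply/eqP.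
  apply: (mulIf (mulf_neq0 ny ny)); rewrite mul0r -oppr0 -[in RHS]E w0 /r.
  by field.
(* The roots of [X^2 + t X + 1] are [r] and [- t - r]; their difference squares to the discriminant
   [t^2 - 4]. *)
have nr : - t - r - r != 0.
  apply/eqP => r0.
  have : (t - 2%:R) * (t + 2%:R) =
      (- t - r - r) ^+ 2 + 4%:R * (r * (- t - r) - 1) by ring.
  rewrite r0 Er subrr mulr0 addr0 expr0n /=.
  by move/eqP; rewrite mulf_eq0 subr_eq0 addr_eq0 (negPf t2) (negPf tm2).
(* With [r' = - t - r], this choice gives the factors [a - r b] and [a - r' b] the values [e] and
   1. *)
pose b := (e - 1) / (- t - r - r).
have Eb : b * (- t - r - r) = e - 1 by rewrite divfK.
exists (e + r * b), b.
have -> : (e + r * b) ^+ 2 + t * (e + r * b) * b + b ^+ 2 =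
    e * (e - b * (- t - r - r)) + b ^+ 2 * (1 - r * (- t - r)) by ring.
by rewrite Eb Er; ring.
Qed.

(** At [s = 2] the conic is the split equation in [a + c]. At [s = -2] it is
    [(a - c)^2 - t (a + c) + 1 = 0]: a parabola if [t] is nonzero, the split equation in [a - c] if
    [t = 0]. *)
Lemma trace_conic_solvable s t : t != 2%:R -> t != - 2%:R ->
  (exists a c, a ^+ 2 + s * a * c + c ^+ 2 - t * a - t * c + 1 = 0) <->
  (s = 2%:R -> split_trace t) /\ (s = - 2%:R -> t != 0 \/ split_trace t).
Proof.
move=> t2 tm2; split=> [[a [c E]] | [H2 Hm2]].
  split=> Es; rewrite Es in E.
    by exists (a + c); rewrite -[RHS]E; ring.
  have [t0|] := eqVneq t 0; [right | by left].
  by exists (a - c); rewrite -[RHS]E t0; ring.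
have n2 := natr2_neq0.
have [Es|s2] := eqVneq s 2%:R.
  have [r Er] := H2 Es; exists r, 0; rewrite -[RHS]Er; ring.
have [Es|sm2] := eqVneq s (- 2%:R).
  have [nt|[r Er]] := Hm2 Es.
    (* On the line [a = c] the quadratic part vanishes, leaving [1 = 2 t a]. *)
    exists (2%:R * t)^-1, (2%:R * t)^-1; rewrite Es; field.
    by rewrite n2 nt.
  exists r, 0; rewrite -[RHS]Er; ring.
have [x [y [w [nz E]]]] := ternary_isotropic 1 1 1 s (- t) (- t).
have [w0|nw] := eqVneq w 0; last first.
  exists (x / w), (y / w).
  apply: (mulIf (mulf_neq0 nw nw)); rewrite mul0r -[in RHS]E.
  by field.
have ny : y != 0.
  apply/eqP => y0; case: nz; split=> //; move: E; rewrite w0 y0.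
  rewrite !(expr0n, mulr0, mul0r, addr0, mul1r) /= => /eqP.
  by rewrite expf_eq0 => /eqP.
(* The conic has rational points at infinity: it is
   [(a - r c) (a - r' c) - t (a + c) + 1 = 0] with [r r' = 1], [r + r' = - s]. *)
pose r := x / y; pose r' := - s - r.
have Er : r * r' = 1.
  apply/eqP; rewrite -subr_eq0; apply/eqP.
  apply: (mulIf (mulf_neq0 ny ny)); rewrite mul0r -oppr0 -[in RHS]E w0 /r' /r.
  by field.
have Es : s = - (r + r') by rewrite /r'; ring.
have nr : r' - r != 0.
  apply/eqP => r0; have : (s - 2%:R) * (s + 2%:R) =
      (r' - r) ^+ 2 + 4%:R * (r * r' - 1) by rewrite Es; ring.
  move/eqP; rewrite r0 Er subrr mulr0 addr0 expr0n /= mulf_eq0 subr_eq0 addr_eq0.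
  by rewrite (negPf s2) (negPf sm2).
(* In the coordinates [u = a - r c], [v = a - r' c] the conic becomes
   [(u - t p) (v - t q) = t^2 p q - 1]; the second factor is set to 1. *)
pose p := - (1 + r) / (r' - r); pose q := (1 + r') / (r' - r).
pose v := t * q + 1; pose u := t * p * v - 1.
pose a := (r' * u - r * v) / (r' - r); pose c := (u - v) / (r' - r).
have Eu : a - r * c = u by rewrite /a /c; field.
have Ev : a - r' * c = v by rewrite /a /c; field.
have Eac : a + c = q * u + p * v by rewrite /a /c /p /q; field.
exists a, c.
have -> : a ^+ 2 + s * a * c + c ^+ 2 - t * a - t * c + 1 =
    (a - r * c) * (a - r' * c) - t * (a + c) + 1 + c ^+ 2 * (1 - r * r').
  by rewrite Es; ring.
by rewrite Eu Ev Eac Er /u /v; ring.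
Qed.

(** * Semisimple classes as trace fibres *)

Lemma SL2_tr_conj_class g t : t != 2%:R -> t != - 2%:R ->
  SL2_tr t g -> conj_class g = SL2_tr t.
Proof.
move=> t2 tm2 [dg tg].
have nscal x : SL2_tr t x -> ~~ is_scalar_mx x.
  move=> [dx tx]; apply/is_scalar_mxP => -[a xa]; move: dx tx.
  rewrite xa scalar_mx2 det_mx2 tr_mx2 mulr0 subr0 => a1 ta.
  have : (t - 2%:R) * (t + 2%:R) = 4%:R * (a * a - 1) by rewrite -ta; ring.
  rewrite a1 subrr mulr0 => /eqP.
  by rewrite mulf_eq0 subr_eq0 addr_eq0 (negPf t2) (negPf tm2).
apply/seteqP; split=> [_ [h dh <-] | x [dx tx]].
  by apply: SL2_tr_conj => //; rewrite unitmxE (dh : \det h = 1) unitr1.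
have [P uP EP] := companionP dg (nscal g (conj dg tg)).
have [Q uQ EQ] := companionP dx (nscal x (conj dx tx)).
rewrite tg in EP; rewrite tx in EQ.
have dP : \det P != 0 by rewrite -unitfE -unitmxE.
have dQ : \det Q != 0 by rewrite -unitfE -unitmxE.
(* [invmx Q *m P] conjugates g to x; its determinant is corrected by an element
   of the centralizer [k[g]] of g. *)
have [a [b Eab]] := norm_form_universal (\det Q / \det P) t2 tm2.
pose m := a%:M + b *: g.
(* The norm from [k[g]]: [\det (a + b g) = a^2 + t a b + b^2]. *)
have dm : \det m = \det Q / \det P.
  rewrite -Eab /m; move: dg tg; have [g1 [g2 [g3 [g4 ->]]]] := mx2P g.
  rewrite det_mx2 tr_mx2 => dg' <-.
  have -> : a%:M + b *: mx2 g1 g2 g3 g4 =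
      mx2 (a + b * g1) (b * g2) (b * g3) (a + b * g4).
    rewrite scalar_mx2; apply/matrixP => i j; rewrite !mxE.
    by case: i => [[|[|]]] //= hi; case: j => [[|[|]]] //= hj; rewrite add0r.
  by rewrite det_mx2 -[b ^+ 2]mulr1 -dg'; ring.
have mg : m *m g = g *m m.
  by rewrite /m mulmxDl mulmxDr -scalemxAl -scalemxAr scalar_mxC.
pose h := invmx Q *m P *m m.
have dh : \det h = 1.
  by rewrite !det_mulmx det_inv dm; field; rewrite dP dQ.
exists h => //; apply: (canLR (mulmxK _)); first by rewrite unitmxE dh unitr1.
have -> : h *m g = invmx Q *m (P *m g) *m m.
  by rewrite /h -mulmxA mg !mulmxA.
rewrite EP /h !mulmxA; congr (_ *m _ *m _).
by rewrite -[RHS](mulKmx uQ) (mulmxA Q) EQ mulmxK.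
Qed.

(** * Squares of trace fibres *)

Lemma SL2_tr_inv t x : SL2_tr t x -> exists2 y, SL2_tr t y & x *m y = 1%:M.
Proof.
have [a [b [c [d ->]]]] := mx2P x; rewrite /SL2_tr /= det_mx2 tr_mx2 => -[dx tx].
(* The adjugate is the inverse and has the same trace. *)
exists (mx2 d (- b) (- c) a); rewrite /= ?det_mx2 ?tr_mx2.
  by split; [rewrite -dx | rewrite -tx]; ring.
by rewrite mul_mx2 scalar_mx2; congr mx2; rewrite -?dx; ring.
Qed.

Lemma SL2_scalar z : is_scalar_mx z -> \det z = 1 -> z = 1%:M \/ z = - 1%:M.
Proof.
move=> /is_scalar_mxP [a ->]; rewrite scalar_mx2 det_mx2 mulr0 subr0 -expr2.
move/eqP; rewrite sqrf_eq1 => /orP [] /eqP ->;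
  [left | right]; rewrite -?scalar_mx2 //.
by rewrite -raddfN.
Qed.

Lemma SL2_tr_sqr_nonscalar t z : t != 2%:R -> t != - 2%:R ->
  \det z = 1 -> ~~ is_scalar_mx z -> class_sqr (SL2_tr t) z <->
  (\tr z = 2%:R -> split_trace t) /\ (\tr z = - 2%:R -> t != 0 \/ split_trace t).
Proof.
move=> t2 tm2 dz nz; rewrite -trace_conic_solvable // -class_sqr_companion.
have [P uP EP] := companionP dz nz; split=> H.
  by rewrite -(mulmxK uP (companion _)) -EP; apply: class_sqr_SL2_tr_conj.
rewrite -(mulKmx uP z) EP mulmxA -{2}(invmxK P).
by apply: class_sqr_SL2_tr_conj; rewrite ?unitmx_inv.
Qed.

Lemma SL2_tr_sqr1 t x : SL2_tr t x -> class_sqr (SL2_tr t) 1%:M.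
Proof. by move=> Dx; have [y Dy xy] := SL2_tr_inv Dx; exists x => //; exists y. Qed.

(** [x y = -1] forces [y = - x^-1], of trace [- t]; in characteristic different from 2, [t = - t]
    means [t = 0]. *)
Lemma SL2_tr_sqrN1 t x : SL2_tr t x -> class_sqr (SL2_tr t) (- 1%:M) <-> t = 0.
Proof.
move=> Dx; split=> [[{Dx}x Dx [y [_ ty] xy]] | t0].
  have [x' [dx' tx'] xx'] := SL2_tr_inv Dx.
  have /(congr1 (mulmx x')) := xy; rewrite mulmxA (mulmx1C xx') mul1mx mulmxN mulmx1.
  move=> yx; have : 2%:R * t = 0 by rewrite mulr_natl mulr2n -[X in X + _]ty yx raddfN /= tx' addNr.
  by move/eqP; rewrite mulf_eq0 (negPf natr2_neq0) => /eqP.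
have [y [dy ty] xy] := SL2_tr_inv Dx.
exists x => //; exists (- y); last by rewrite /= mulmxN xy.
by split; [rewrite -scaleN1r detZ dy sqrrN expr1n mulr1 | rewrite raddfN /= ty t0 oppr0].
Qed.

Lemma SL2_tr_sqr_det t z : class_sqr (SL2_tr t) z -> SL2 k z.
Proof. by move=> [x [dx _] [y [dy _] <-]]; rewrite /SL2 /= det_mulmx dx dy mulr1. Qed.

(** * Traces of split and non-split classes *)

Lemma split_trace0 : split_trace 0 <-> nz_squares k (-1).
Proof.
split=> [[r Er] | [b _ Eb]].
  have Eb : -1 = r ^+ 2 by apply/eqP; rewrite eq_sym -subr_eq0 opprK -[X in _ == X]Er mul0r subr0.
  by exists r => //; apply: contra_eqN Eb => /eqP ->; rewrite expr0n /= oppr_eq0 oner_eq0.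
by exists b; rewrite -Eb; ring.
Qed.

(** The eigenvalues [a], [b] have product 1 and differ because [g] is not central; then
    [(\tr g)^2 - 4 = (a - b)^2] excludes the traces 2 and -2. *)
Lemma diagonalizable_tr g : \det g = 1 -> ~ central g -> diagonalizable g ->
  [/\ \tr g != 2%:R, \tr g != - 2%:R & split_trace (\tr g)].
Proof.
move=> dg ncg [P uP /similar_diagPex [D /(similarP uP) PD]].
have gE : g = invmx P *m diag_mx D *m P.
  by rewrite -mulmxA -PD mulKmx.
pose a := D 0 0; pose b := D 0 1.
have DE : diag_mx D = mx2 a 0 0 b.
  apply/matrixP => i j; rewrite !mxE.
  case: i => [[|[|]]] //= hi; case: j => [[|[|]]] //= hj;
    by rewrite ?mulr1n // /a /b; congr (D _ _); apply: val_inj.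
have ab1 : a * b = 1.
  rewrite -dg gE !det_mulmx det_inv mulrAC mulVr -?unitmxE // mul1r.
  by rewrite DE det_mx2 mulr0 subr0.
have abt : a + b = \tr g.
  by rewrite gE mxtrace_mulC mulmxA mulmxV // mul1mx DE tr_mx2.
have nab : a - b != 0.
  rewrite subr_eq0; apply/eqP => Eab; apply: ncg => h _.
  by rewrite gE DE -Eab -scalar_mx2 scalar_mxC mulmxKV // scalar_mxC.
have D4 : (\tr g - 2%:R) * (\tr g + 2%:R) = (a - b) ^+ 2.
  by rewrite -abt -[RHS]addr0 -(mulr0 4%:R) -(subrr (a * b)) {2}ab1; ring.
have : (\tr g - 2%:R) * (\tr g + 2%:R) != 0 by rewrite D4 expf_neq0.
rewrite mulf_eq0 subr_eq0 addr_eq0 negb_or => /andP [t2 tm2]; split=> //.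
by exists a; rewrite -abt -ab1; ring.
Qed.

Lemma irreducible_char_poly_tr g : \det g = 1 ->
  irreducible_poly (char_poly g) -> ~ split_trace (\tr g).
Proof.
move=> dg [_ irr] [r Er].
have : 'X - r%:P %| char_poly g.
  rewrite dvdp_XsubCl char_poly_mx2E // /root !hornerE -[X in _ == X]Er.
  by apply/eqP; ring.
move/irr; rewrite size_XsubC => /(_ isT) /eqp_size.
by rewrite size_XsubC size_char_poly.
Qed.

End Proposition.

Lemma nonsplit_trace_neq2 (k : fieldType) (t : k) : ~ split_trace t ->
  t != 2%:R /\ t != - 2%:R.
Proof.
by move=> nr; split; apply/eqP => tE; apply: nr;
  [exists 1 | exists (-1)]; rewrite tE; ring.
Qed.


Theorem proposition3p2 (k : fieldType)
    (hu : u_le2 k) (hq : ~ quadratically_closed k)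
    (hchar : 2%N \notin [pchar k]) (hcard : card_ge5 k)
    (C : set 'M[k]_2) (hC : semisimple_class C) :
  (split_class C ->
     (class_tr C <> 0 -> class_sqr C = SL2 k `\` [set - 1%:M]) /\
     (class_tr C = 0 -> nz_squares k (-1) /\ class_sqr C = SL2 k)) /\
  (nonsplit_class C ->
     (class_tr C <> 0 ->
        class_sqr C = SL2 k `\` (unipotents k `|` [set - 1%:M])) /\
     (class_tr C = 0 ->
        ~ nz_squares k (-1) /\
        class_sqr C = SL2 k `\` (unipotents k `|` neg_unipotents k))).
Proof.
have [g [dg _ ncg CE]] := hC.
have Cg : C g by rewrite CE; exists 1%:M; rewrite /SL2 /= ?det1 // invmx1 mul1mx mulmx1.
have Dt : SL2_tr (class_tr C) g by rewrite (class_trE hC Cg); split.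
rewrite /split_class /nonsplit_class; set t := class_tr C in Dt *.
have tE : t = \tr g by case: Dt => _ ->.
have CD : t != 2%:R -> t != - 2%:R -> class_sqr C = class_sqr (SL2_tr t).
  by move=> t2 tm2; rewrite CE (SL2_tr_conj_class hu t2 tm2 Dt).
have scN (e : k) : is_scalar_mx (e%:M : 'M_2) by apply: scalar_mx_is_scalar.
have N1sc : is_scalar_mx (- 1%:M : 'M[k]_2) by rewrite -raddfN scN.
split=> [/(_ g Cg) diag | /(_ g Cg) irr].
  have := diagonalizable_tr dg ncg diag; rewrite -tE => -[t2 tm2 rt].
  (* In the split case both trace conditions hold, so only [-1] can be missing from the square. *)
  have sqr_of z : SL2 k z -> ~~ is_scalar_mx z -> class_sqr (SL2_tr t) z.
    by move=> dz nz; apply/(SL2_tr_sqr_nonscalar hu hchar t2 tm2 dz nz); split; auto.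
  split=> [/eqP nt | t0]; last first.
    split; first by apply/split_trace0; rewrite -t0.
    rewrite CD //; apply/seteqP; split=> z; first exact: SL2_tr_sqr_det.
    move=> dz; have [sz|] := boolP (is_scalar_mx z); last exact: sqr_of.
    have [->|->] := SL2_scalar sz dz; first exact: SL2_tr_sqr1 Dt.
    exact/(SL2_tr_sqrN1 hchar Dt).
  rewrite CD //; apply/seteqP; split=> z.
    move=> Cz; split; first exact: SL2_tr_sqr_det Cz.
    by move=> /= zE; move: Cz nt; rewrite zE => /(SL2_tr_sqrN1 hchar Dt) ->; rewrite eqxx.
  move=> [dz nz]; have [sz|] := boolP (is_scalar_mx z); last exact: sqr_of.
  have [->|//] := SL2_scalar sz dz; exact: SL2_tr_sqr1 Dt.
(* In the non-split case a non-scalar [z] is missed exactly when its trace is 2 (unipotent), or when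
   its trace is -2 (negative unipotent) and [t = 0]. *)
have nrt : ~ split_trace t by rewrite tE; exact: irreducible_char_poly_tr.
have [t2 tm2] := nonsplit_trace_neq2 nrt.
rewrite CD //; split=> [/eqP nt | t0].
  apply/seteqP; split=> z.
    move=> Cz; have dz := SL2_tr_sqr_det Cz; split=> //.
    case=> [/(unipotentsP dz) [nz tz] | /= zE].
      by have /(SL2_tr_sqr_nonscalar hu hchar t2 tm2 dz nz) [/(_ tz)] := Cz.
    by move: Cz nt; rewrite zE => /(SL2_tr_sqrN1 hchar Dt) ->; rewrite eqxx.
  move=> [dz nzz]; have [sz|nz] := boolP (is_scalar_mx z).
    have [->|zE] := SL2_scalar sz dz; first exact: SL2_tr_sqr1 Dt.
    by case: nzz; right.
  apply/(SL2_tr_sqr_nonscalar hu hchar t2 tm2 dz nz); split; last by left.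
  by move=> tz; case: nzz; left; apply/(unipotentsP dz).
split; first by move=> /split_trace0; rewrite -t0.
apply/seteqP; split=> z.
  move=> Cz; have dz := SL2_tr_sqr_det Cz; split=> //.
  case=> [/(unipotentsP dz) | /(neg_unipotentsP dz)] [nz tz];
    have /(SL2_tr_sqr_nonscalar hu hchar t2 tm2 dz nz) [H Hm] := Cz.
    exact: nrt (H tz).
  by have [|//] := Hm tz; rewrite t0 eqxx.
move=> [dz nzz]; have [sz|nz] := boolP (is_scalar_mx z).
  have [->|->] := SL2_scalar sz dz; first exact: SL2_tr_sqr1 Dt.
  exact/(SL2_tr_sqrN1 hchar Dt).
apply/(SL2_tr_sqr_nonscalar hu hchar t2 tm2 dz nz); split=> tz; case: nzz.
  by left; apply/(unipotentsP dz).
by right; apply/(neg_unipotentsP dz).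
Qed.
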